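(* Every bipartite amoeba $G$ is omnitonal, and ${\rm ot}(n,G)={\rm ex}(n,G)$ and ${\rm Ot}(n,G)={\rm Ex}(n,G)$ for every $n$ satisfying $\binom n2\ge 2\,{\rm ex}(n,G)+1$ and $n\ge n_0(G)$.
   Context: Graphs are finite and simple with at least one edge; $n(G)=|V(G)|$, $e(G)=|E(G)|$. Amoebas. Isolated vertices play no role here, so copies of $G$ in $K_n$ are regarded as determined by their edge sets. For a graph $G$ embedded in $K_n$, $n\ge n(G)$, a graph $H$ embedded in $K_n$ is obtained from $G$ by an edge-replacement if for some $e_1\in E(G)$ and $e_2\in E(K_n)\setminus E(G)$ we have $E(H)=(E(G)\setminus\{e_1\})\cup\{e_2\}$. A graph $G$ is an amoeba if there is an integer $n_0=n_0(G)>n(G)$ such that for all $n\ge n_0$ and any two copies $F$ and $H$ of $G$ in $K_n$ there is a chain $F=G_0,G_1,\dots,G_t=H$ such that, for every $i\in\{1,\dots,t\}$, $G_i\cong G$ and $G_i$ is obtained from $G_{i-1}$ by an edge-replacement. Turán numbers. ${\rm ex}(n,G)$ is the maximum number of edges in an $n$-vertex graph containing no copy of $G$, and ${\rm Ex}(n,G)$ is the family (up to isomorphism) of $n$-vertex graphs with ${\rm ex}(n,G)$ edges containing no copy of $G$. Omnitonal graphs. A $2$-coloring $E(K_n)=E(R)\cup E(B)$ is a partition of the edges of $K_n$ into red and blue edges, forming the spanning subgraphs $R$ and $B$. An $(r,b)$-colored copy of $G$ (with $r+b=e(G)$) is a (not necessarily induced) subgraph of $K_n$ isomorphic to $G$ with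 exactly $r$ red and $b$ blue edges. ${\rm ot}(n,G)$ is the minimum non-negative integer $s$ such that every $2$-coloring $E(K_n)=E(R)\cup E(B)$ with $\min\{e(R),e(B)\}>s$ contains an $(r,b)$-colored copy of $G$ for every pair of integers $r,b\ge0$ with $r+b=e(G)$. The graph $G$ is omnitonal if for every sufficiently large $n$ such an integer exists non-vacuously, that is, ${\rm ot}(n,G)<\lfloor\frac12\binom n2\rfloor$ (so that there are colorings with $\min\{e(R),e(B)\}>{\rm ot}(n,G)$). ${\rm Ot}(n,G)$ is the family (up to isomorphism) of $n$-vertex graphs with exactly ${\rm ot}(n,G)$ edges such that a coloring $E(K_n)=E(R)\cup E(B)$ with $\min\{e(R),e(B)\}={\rm ot}(n,G)$ contains no $(r,b)$-colored copy of $G$ for some pair $r,b\ge0$ with $r+b=e(G)$ if and only if $R$ or $B$ is isomorphic to some $H\in{\rm Ot}(n,G)$. *)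

(* Defs.v *)
From HB Require Import structures.
From mathcomp Require Import all_boot all_fingroup.

Set Implicit Arguments.
Unset Strict Implicit.
Unset Printing Implicit Defensive.

(* Edges are 2-element sets of vertices, so that edge-replacement is a set     *)
(* operation; the spanning subgraphs of K_n are the elements of graph 'I_n.    *)
Definition complete (T : finType) : {set {set T}} :=
  [set e : {set T} | #|e| == 2].

Record graph (T : finType) := Graph {
  edges : {set {set T}};
  edges_simple : edges \subset complete T
}.

HB.instance Definition _ (T : finType) := [isSub for @edges T].
HB.instance Definition _ (T : finType) := [Finite of graph T by <:].

Definition bipartite (T : finType) (G : graph T) : Prop :=
  exists A : {set T},
    forall x y, [set x; y] \in edges G -> (x \in A) != (y \in A).

Definition iso (n : nat) (H1 H2 : graph 'I_n) : bool :=
  [exists s : {perm 'I_n},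
    edges H2 == [set [set s x | x in e] | e : {set 'I_n} in edges H1]].

(* A copy of G in K_n is determined by its edge set. When #|T| <= n this is    *)
(* isomorphism to G up to isolated vertices.                                   *)
Definition is_copy (T : finType) (G : graph T) (n : nat) (F : graph 'I_n) :
    bool :=
  [exists f : {ffun T -> 'I_n}, injectiveb f &&
    (edges F == [set [set f x | x in e] | e : {set T} in edges G])].

Definition contains_copy (T : finType) (G : graph T) (n : nat)
    (H : graph 'I_n) : bool :=
  [exists F : graph 'I_n, is_copy G F && (edges F \subset edges H)].

Definition edge_replacement (n : nat) (F H : graph 'I_n) : bool :=
  [exists e1 in edges F, exists e2 in complete 'I_n :\: edges F,
    edges H == e2 |: (edges F :\ e1)].

Definition amoeba_threshold (T : finType) (G : graph T) (n0 : nat) : Prop :=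
  #|T| < n0 /\
  forall n, n0 <= n -> forall F H : graph 'I_n, is_copy G F -> is_copy G H ->
    exists c : seq (graph 'I_n),
      [/\ path (@edge_replacement n) F c, all (is_copy G (n:=n)) c
        & last F c = H].

Definition amoeba (T : finType) (G : graph T) : Prop :=
  exists n0, amoeba_threshold G n0.

Definition ex (n : nat) (T : finType) (G : graph T) : nat :=
  \max_(H : graph 'I_n | ~~ contains_copy G H) #|edges H|.

(* Families of n-vertex graphs up to isomorphism are represented by            *)
(* isomorphism-closed sets of graphs on 'I_n.                                  *)
Definition Ex (n : nat) (T : finType) (G : graph T) : {set graph 'I_n} :=
  [set H : graph 'I_n | ~~ contains_copy G H & #|edges H| == ex n G].

Definition coloring (n : nat) (R B : graph 'I_n) : bool :=
  (edges R :|: edges B == complete 'I_n) && [disjoint edges R & edges B].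

Definition colored_copy (T : finType) (G : graph T) (n : nat)
    (R B : graph 'I_n) (r b : nat) : bool :=
  [exists F : graph 'I_n, [&& is_copy G F,
    #|edges F :&: edges R| == r & #|edges F :&: edges B| == b]].

Definition all_colored_copies (T : finType) (G : graph T) (n : nat)
    (R B : graph 'I_n) : bool :=
  [forall r : 'I_(#|edges G|.+1), forall b : 'I_(#|edges G|.+1),
    (r + b == #|edges G|) ==> colored_copy G R B r b].

Lemma all_colored_copiesP (T : finType) (G : graph T) (n : nat)
    (R B : graph 'I_n) :
  reflect (forall r b, r + b = #|edges G| -> colored_copy G R B r b)
          (all_colored_copies G R B).
Proof.
apply: (iffP forallP) => [h r b rb | h r].
  have hr : r < #|edges G|.+1 by rewrite ltnS -rb leq_addr.
  have hb : b < #|edges G|.+1 by rewrite ltnS -rb leq_addl.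
  by have /forallP/(_ (Ordinal hb))/implyP := h (Ordinal hr); apply; apply/eqP.
by apply/forallP => b; apply/implyP => /eqP; apply: h.
Qed.

Definition ot_bound (n : nat) (T : finType) (G : graph T) (s : nat) : bool :=
  [forall R : graph 'I_n, forall B : graph 'I_n,
    coloring R B && (s < minn #|edges R| #|edges B|) ==>
    all_colored_copies G R B].

Lemma ot_bound_exists (n : nat) (T : finType) (G : graph T) :
  exists s, ot_bound n G s.
Proof.
exists #|complete 'I_n|; apply/forallP => R; apply/forallP => B.
apply/implyP => /andP[_]; rewrite leq_min => /andP[+ _].
by rewrite ltnNge (subset_leq_card (edges_simple R)).
Qed.

Definition ot (n : nat) (T : finType) (G : graph T) : nat :=
  ex_minn (ot_bound_exists n G).

Definition omnitonal (T : finType) (G : graph T) : Prop :=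
  exists N, forall n, N <= n -> ot n G < 'C(n, 2)./2.

(* Ot(n, G) is given by a characteristic property rather than a formula; that *)
(* it equals a family X is expressed by forall O, is_Ot G O <-> O = X          *)
(* (existence and uniqueness).                                                 *)
Definition is_Ot (n : nat) (T : finType) (G : graph T)
    (O : {set graph 'I_n}) : Prop :=
  [/\ forall H1 H2, iso H1 H2 -> H1 \in O -> H2 \in O,
      forall H, H \in O -> #|edges H| = ot n G
    & forall R B : graph 'I_n, coloring R B ->
        minn #|edges R| #|edges B| = ot n G ->
        (exists r b, r + b = #|edges G| /\ ~~ colored_copy G R B r b) <->
        (exists2 H, H \in O & iso R H \/ iso B H)].

(* Main.v *)
(* If both colour classes contain a copy of G, a chain of edge-replacements    *)
(* joins a red copy to a blue one; the number of red edges changes by at most  *)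
(* one at each step, so it takes every value. Hence a coloring misses some     *)
(* (r,b)-pattern exactly when R or B is G-free, which gives ot = ex and        *)
(* Ot = Ex. For omnitonality it remains to see that a graph with half of the   *)
(* edges of K_n contains K_{t,t} for n large: choose 16t vertices of degree at *)
(* least n/8; at least n/16 vertices have t or more neighbours among them, and *)
(* by pigeonhole t of these see the same subset of the chosen vertices.        *)
Require Import Defs.
From mathcomp Require Import all_boot all_fingroup.
From mathcomp Require Import zify.

Set Implicit Arguments.
Unset Strict Implicit.
Unset Printing Implicit Defensive.

(** The core is [missing_pattern_iff]: for n at least the amoeba threshold, a coloring misses a
    pattern iff some colour class is G-free. A G-free class excludes its monochromatic pattern;
    conversely [all_colors_of_amoeba] walks from a red copy to a blue one.

    So ot <= ex, since classes with more than ex edges contain G. If ex is below half of all edges,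
    an extremal graph and its complement form a coloring whose smaller class is G-free, so ot >= ex
    ([ex_le_ot]). Then [is_Ot_Ex] shows that Ex satisfies the characterization of Ot, and
    [is_Ot_inclusion], used both ways, gives uniqueness.

    Bipartiteness enters only in [ex_lt_half], which puts ex below half of all edges for large n. *)

Lemma path_intermediate_value (S : Type) (e : rel S) (g : S -> nat) (r : nat)
    (P : pred S) (x : S) (c : seq S) :
  (forall y z, e y z -> g y <= (g z).+1) ->
  path e x c -> P x -> all P c -> g (last x c) <= r <= g x ->
  exists2 y, P y & g y = r.
Proof.
move=> step; elim: c x => [|y c IH] x /=.
  by move=> _ Px _ rx; exists x => //; apply/eqP; rewrite eqn_leq.
case/andP=> exy pc Px /andP[Py Pc] /andP[lr rx].
(* Otherwise [g x] exceeds [r], and a drop of at most one keeps [g y] at least [r]. *)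
have [gxr|ltr] := eqVneq (g x) r; first by exists x.
apply: (IH y) => //; rewrite lr /=; have := step _ _ exy; lia.
Qed.

(** The average of [f] is at least m/k. Elements with value below m/(2k) contribute at most half of
    the total, so the others, worth at most [m] each, must make up the rest. *)
Lemma popular_elements (I : finType) (f : I -> nat) (m k : nat) :
  0 < m -> (forall i, f i <= m) -> #|I| * m <= k * \sum_i f i ->
  #|I| <= 2 * k * #|[set i | m <= 2 * k * f i]|.
Proof.
move=> m_gt0 fm avg; set D := [set i | _].
have bound : 2 * k * \sum_i f i <= 2 * k * #|D| * m + #|I| * m.
  rewrite (bigID (mem D)) /= mulnDr leq_add //.
    by rewrite -[leqRHS]mulnA leq_mul // -sum_nat_const leq_sum.
  rewrite big_distrr /=.
  apply: (@leq_trans (\sum_(i | i \notin D) m)).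
    by apply: leq_sum => i; rewrite inE -ltnNge => /ltnW.
  by rewrite sum_nat_const leq_mul2r max_card orbT.
by rewrite -(leq_pmul2r m_gt0); lia.
Qed.

Lemma large_fiber (I J : finType) (h : I -> J) (Y : {set I}) (P : {set J})
    (t : nat) :
  {in Y, forall i, h i \in P} -> #|P| * t < #|Y| ->
  exists2 j, j \in P & t < #|[set i in Y | h i == j]|.
Proof.
move=> hP big; apply/exists_inP; apply: contraTT big.
rewrite negb_exists_in -leqNgt => /forall_inP small.
rewrite -sum1_card (partition_big h (mem P)) //= -sum_nat_const.
apply: leq_sum => j /small; rewrite -leqNgt; apply: leq_trans.
by rewrite -sum1_card; apply: eq_leq; apply: eq_bigl => i; rewrite inE.
Qed.

Lemma subset_of_card (I : finType) (D : {set I}) (k : nat) :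
  k <= #|D| -> exists2 X : {set I}, X \subset D & #|X| = k.
Proof.
move=> kD; exists [set x in take k (enum D)].
  by apply/subsetP => x; rewrite inE => /mem_take; rewrite mem_enum.
rewrite cardsE (card_uniqP _) ?take_uniq ?enum_uniq //.
by rewrite size_takel // -cardE.
Qed.

(** * Complete bipartite subgraphs of dense graphs, and the bound on ex *)

Lemma edge_card (S : finType) (H : graph S) e : e \in edges H -> #|e| = 2.
Proof. by move/(subsetP (edges_simple H)); rewrite inE => /eqP. Qed.

Lemma edge_neq (S : finType) (H : graph S) x y :
  [set x; y] \in edges H -> x != y.
Proof. by move/edge_card; rewrite cards2; case: (x != y). Qed.

Definition neighbors (S : finType) (H : graph S) (v : S) : {set S} :=
  [set u | [set v; u] \in edges H].

Lemma neighborsC (S : finType) (H : graph S) u v :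
  (u \in neighbors H v) = (v \in neighbors H u).
Proof. by rewrite !inE setUC. Qed.

Lemma sum_degrees_ge (S : finType) (H : graph S) :
  2 * #|edges H| <= \sum_v #|neighbors H v|.
Proof.
rewrite mulnC -sum_nat_const.
rewrite (eq_bigr (fun e : {set S} => \sum_(v in e) 1)) => [|e /edge_card <-];
  last by rewrite sum1_card.
rewrite (exchange_big_dep predT) //=; apply: leq_sum => v _.
rewrite sum1_card; apply: leq_trans (leq_imset_card (fun u => [set v; u]) _).
apply/subset_leq_card/subsetP => e /andP[eH ve].
have /cards2P[x [y [xy def_e]]] : #|e| == 2 by rewrite (edge_card eH).
move: ve; rewrite def_e !inE => /orP[] /eqP ->.
  by apply: imset_f; rewrite inE -def_e.
by rewrite setUC; apply: imset_f; rewrite inE setUC -def_e.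
Qed.

Lemma biclique_of_dense (t n : nat) (H : graph 'I_n) :
  128 * t < n -> 16 * 2 ^ (16 * t) * t < n -> n * n <= 8 * #|edges H| ->
  exists S Z : {set 'I_n}, [/\ t <= #|S|, t <= #|Z|
    & forall s z, s \in S -> z \in Z -> [set s; z] \in edges H].
Proof.
(* The case t = 0 is split off because the second averaging has [m] = 16t, which must be
   positive. *)
case: t => [|t] tn Mn dense.
  by exists set0, set0; rewrite cards0; split=> // s z; rewrite inE.
set D := [set v | n <= 2 * 4 * #|neighbors H v|].
have n_gt0 : 0 < n by lia.
have D_big : n <= 2 * 4 * #|D|.
  rewrite -[leqLHS]card_ord; apply: popular_elements => // [v|].
    by rewrite -[leqRHS]card_ord max_card.
  rewrite card_ord (leq_trans dense) // -[8]/(4 * 2) -mulnA leq_mul2l.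
  exact: sum_degrees_ge.
have [|X XD cardX] := @subset_of_card _ D (16 * t.+1); first lia.
set N := fun v => neighbors H v :&: X.
set Y := [set v | #|X| <= 2 * 8 * #|N v|].
have Y_big : n <= 2 * 8 * #|Y|.
  rewrite -[leqLHS]card_ord; apply: popular_elements => [|v|].
  - by rewrite cardX.
  - by rewrite subset_leq_card ?subsetIr.
  have -> : \sum_v #|N v| = \sum_(x in X) #|neighbors H x|.
    rewrite (eq_bigr (fun v => \sum_(x in X | x \in neighbors H v) 1)).
      rewrite (exchange_big_dep (mem X)) /=; last by move=> ? ? _ /andP[].
      apply: eq_bigr => x xX; rewrite -sum1_card.
      by apply: eq_bigl => v; rewrite xX neighborsC.
    by move=> v _; rewrite -sum1_card; apply: eq_bigl => x; rewrite inE andbC.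
  rewrite card_ord mulnC big_distrr /= -sum_nat_const; apply: leq_sum => x xX.
  by have := subsetP XD _ xX; rewrite inE.
(* More than 2^(16t) * t vertices lie in [Y], so more than t of them share one trace [S] on [X]. *)
have [v _||S _ S_big] := @large_fiber _ _ N Y (powerset X) t.+1.
- by rewrite powersetE subsetIr.
- by rewrite card_powerset cardX; lia.
exists S, [set v in Y | N v == S]; split; last 1 first.
- move=> s z sS; rewrite inE => /andP[_ /eqP NzS].
  by move: sS; rewrite -NzS !inE setUC => /andP[].
(* Any [v] in the fiber has [N v] = [S], and membership in [Y] gives |S| >= |X|/16 = t. *)
- have /card_gt0P[v] : 0 < #|[set v in Y | N v == S]| by apply: leq_trans S_big.
  by rewrite !inE => /andP[+ /eqP <-]; rewrite cardX; lia.
- exact: ltnW.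
Qed.

(** Each vertex goes to the element of [S] or [Z], according to its side, at the position of its
    rank in [T]. Both sets have at least |T| elements, so the default of [nth] is never reached;
    they are disjoint because edges have distinct ends. *)
Lemma contains_copy_biclique (T : finType) (G : graph T) (n : nat)
    (H : graph 'I_n) (S Z : {set 'I_n}) :
  bipartite G -> 0 < n -> #|T| <= #|S| -> #|T| <= #|Z| ->
  (forall s z, s \in S -> z \in Z -> [set s; z] \in edges H) ->
  contains_copy G H.
Proof.
move=> [A bipA] n_gt0 TS TZ SZ.
pose side x := if x \in A then S else Z.
pose f := [ffun x : T => nth (Ordinal n_gt0) (enum (side x)) (enum_rank x)].
have lt_side x : enum_rank x < size (enum (side x)).
  by rewrite -cardE; apply: leq_trans (ltn_ord _) _; rewrite /side; case: ifP.
have f_side x : f x \in side x by rewrite ffunE -mem_enum mem_nth.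
have SZ_neq s z : s \in S -> z \in Z -> s != z.
  by move=> sS zZ; apply: edge_neq (SZ _ _ sS zZ).
have f_inj : injective f.
  move=> x y fxy; have := f_side x; have := f_side y; rewrite fxy /side.
  have [side_xy _ _|] := eqVneq (x \in A) (y \in A).
    have := fxy; rewrite !ffunE /side side_xy => /eqP.
    rewrite nth_uniq ?enum_uniq //.
    - by move=> /eqP/val_inj/enum_rank_inj.
    - by have := lt_side x; rewrite /side side_xy.
  case: (x \in A) (y \in A) => [] [] // _ yV xV.
    by have /eqP := SZ_neq _ _ xV yV.
  by have /eqP := SZ_neq _ _ yV xV.
pose E := [set [set f x | x in e] | e : {set T} in edges G].
have EH : E \subset edges H.
  apply/subsetP => _ /imsetP[e eG ->].
  have /cards2P[x [y [_ def_e]]] : #|e| == 2 by rewrite (edge_card eG).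
  move: eG (f_side x) (f_side y); rewrite def_e imsetU !imset_set1 /side.
  move=> /bipA; case: (x \in A) (y \in A) => [] [] // _ fx fy; first exact: SZ.
  by rewrite setUC; apply: SZ.
have E_simple := subset_trans EH (edges_simple H).
apply/existsP; exists (Graph E_simple); rewrite EH andbT.
by apply/existsP; exists f; rewrite eqxx andbT; apply/injectiveP.
Qed.

Lemma ex_lt_half (T : finType) (G : graph T) :
  bipartite G -> exists N, forall n, N <= n -> ex n G < 'C(n, 2)./2.
Proof.
move=> bipG; set t := #|T|.
(* The first two terms meet the size conditions of [biclique_of_dense]; with n >= 4, half of the
   edges of K_n is positive and at least n^2/8. *)
exists (128 * t + 16 * 2 ^ (16 * t) * t + 4) => n le_n.
have C2 : 2 * 'C(n, 2) = n * n.-1 by rewrite -[n.-1]bin1 mul_bin_diag.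
have half_gt0 : 0 < 'C(n, 2)./2 by nia.
rewrite /ex; apply: (big_ind (fun m => m < _)) => // [x y|H].
  by rewrite gtn_max => ->.
apply: contraR; rewrite -leqNgt => dense.
have [||| S [Z [S_big Z_big SZ]]] := @biclique_of_dense t n H; try nia.
by apply: contains_copy_biclique SZ => //; lia.
Qed.

(** * Copies, isomorphism and extremal graphs *)

Lemma is_copy_card (T : finType) (G : graph T) n (F : graph 'I_n) :
  is_copy G F -> #|edges F| = #|edges G|.
Proof.
case/existsP => f /andP[/injectiveP f_inj /eqP ->].
by rewrite card_imset //; apply: imset_inj.
Qed.

Lemma iso_card n (H1 H2 : graph 'I_n) : iso H1 H2 -> #|edges H1| = #|edges H2|.
Proof.
case/existsP => s /eqP ->; rewrite card_imset //.
exact/imset_inj/perm_inj.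
Qed.

Lemma iso_refl n (H : graph 'I_n) : iso H H.
Proof.
apply/existsP; exists 1%g; apply/eqP.
rewrite -[LHS]imset_id; apply: eq_imset => e; rewrite -[LHS]imset_id.
by apply: eq_imset => x; rewrite perm1.
Qed.

Lemma iso_sym n (H1 H2 : graph 'I_n) : iso H1 H2 -> iso H2 H1.
Proof.
case/existsP => s /eqP def_H2; apply/existsP; exists (s^-1)%g; apply/eqP.
rewrite def_H2 -imset_comp -[LHS]imset_id; apply: eq_imset => e /=.
rewrite -imset_comp -[LHS]imset_id; apply: eq_imset => x /=.
by rewrite permK.
Qed.

Lemma contains_copy_iso (T : finType) (G : graph T) n (H1 H2 : graph 'I_n) :
  iso H1 H2 -> contains_copy G H1 -> contains_copy G H2.
Proof.
case/existsP => s /eqP def_H2 /existsP[F /andP[/existsP[f]]].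
case/andP=> /injectiveP f_inj /eqP def_F FH1.
pose E := [set [set s x | x in e] | e : {set 'I_n} in edges F].
have EH2 : E \subset edges H2 by rewrite def_H2 imsetS.
have E_simple := subset_trans EH2 (edges_simple H2).
apply/existsP; exists (Graph E_simple); rewrite EH2 andbT.
apply/existsP; exists [ffun x => s (f x)]; apply/andP; split.
  by apply/injectiveP => x y; rewrite !ffunE => /perm_inj/f_inj.
apply/eqP; rewrite /= /E def_F -imset_comp; apply: eq_imset => e /=.
by rewrite -imset_comp; apply: eq_imset => x; rewrite /= ffunE.
Qed.

Lemma contains_copy_ex (T : finType) (G : graph T) n (H : graph 'I_n) :
  ex n G < #|edges H| -> contains_copy G H.
Proof.
by rewrite ltnNge; apply: contraR => ncH; rewrite /ex leq_bigmax_cond.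
Qed.

(** As [G] has an edge, the empty graph is G-free, so the maximum ranges over a nonempty family. *)
Lemma ex_attained (T : finType) (G : graph T) n :
  edges G != set0 -> exists H : graph 'I_n, H \in Ex n G.
Proof.
move=> G_edge; pose H0 : graph 'I_n := Graph (sub0set _).
have ncH0 : ~~ contains_copy G H0.
  apply/existsPn => F; apply/negP => /andP[/is_copy_card cardF].
  rewrite subset0 => /eqP F0; move: cardF; rewrite F0 cards0 => /esym/eqP.
  by rewrite cards_eq0 (negPf G_edge).
have := @eq_bigmax_cond _ (fun H => ~~ contains_copy G H)
  (fun H : graph 'I_n => #|edges H|).
case=> [|H ncH exH]; first by apply/card_gt0P; exists H0.
by exists H; rewrite inE; apply/andP; split; rewrite // /ex exH.
Qed.

(** * Colorings of K_n: patterns, ot and Ot *)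

Section Colorings.
Variables (T : finType) (G : graph T) (n : nat).
Implicit Types (R B F : graph 'I_n).

Lemma coloring_card R B F : coloring R B ->
  #|edges F :&: edges R| + #|edges F :&: edges B| = #|edges F|.
Proof.
case/andP => /eqP RB disj; rewrite -cardsUI setIACA setIid -setIUr RB.
rewrite (setIidPl (edges_simple F)); move: disj; rewrite -setI_eq0 => /eqP ->.
by rewrite setI0 cards0 addn0.
Qed.

Lemma coloring_total R B : coloring R B -> #|edges R| + #|edges B| = 'C(n, 2).
Proof.
case/andP => /eqP RB; rewrite -setI_eq0 => /eqP disj.
by rewrite -cardsUI RB disj cards0 addn0 card_draws card_ord.
Qed.

Lemma coloring_complement R : exists B, coloring R B.
Proof.
exists (Graph (subsetDl (complete 'I_n) (edges R))); rewrite /coloring /=.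
by rewrite setDE setUIr setUCr setIT (setUidPr (edges_simple R)) eqxx
  -setI_eq0 setICA setICr setI0 eqxx.
Qed.

Lemma colored_copyC R B r b : colored_copy G R B r b = colored_copy G B R b r.
Proof. by apply: eq_existsb => F; rewrite [X in _ && X]andbC. Qed.

Lemma contains_copy_monochromatic R B :
  colored_copy G R B #|edges G| 0 -> contains_copy G R.
Proof.
case/existsP => F /and3P[copyF /eqP FR _]; apply/existsP; exists F.
rewrite copyF; apply/setIidPl/eqP.
by rewrite eqEcard subsetIl FR (is_copy_card copyF) leqnn.
Qed.

(** Only the deleted edge can leave the intersection with [E]. *)
Lemma edge_replacement_card (E : {set {set 'I_n}}) F H :
  edge_replacement F H -> #|edges F :&: E| <= #|edges H :&: E|.+1.
Proof.
case/exists_inP => e1 _ /exists_inP[e2 _ /eqP ->].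
apply: (@leq_trans #|e1 |: ((e2 |: edges F :\ e1) :&: E)|).
  apply/subset_leq_card/subsetP => e; rewrite !inE => /andP[-> ->].
  by rewrite !andbT; case: (e == e1); rewrite ?orbT.
by rewrite cardsU1; case: (_ \notin _); rewrite ?add0n ?add1n.
Qed.

Lemma all_colors_of_amoeba n0 R B : amoeba_threshold G n0 -> n0 <= n ->
  coloring R B -> contains_copy G R -> contains_copy G B ->
  forall r b, r + b = #|edges G| -> colored_copy G R B r b.
Proof.
move=> [_ amoebaG] le_n col.
move=> /existsP[F /andP[copyF FR]] /existsP[H /andP[copyH HB]].
move=> r b rb.
have [c [path_c copy_c last_c]] := amoebaG n le_n F H copyF copyH.
have FR_card : #|edges F :&: edges R| = r + b.
  by rewrite (setIidPl FR) (is_copy_card copyF) rb.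
have HR_card : #|edges H :&: edges R| = 0.
  by have := coloring_card H col; rewrite (setIidPl HB); lia.
have [|K copyK KR] := @path_intermediate_value _ _
  (fun K => #|edges K :&: edges R|) r _ F c (@edge_replacement_card _)
  path_c copyF copy_c.
  by rewrite last_c FR_card HR_card leq_addr.
apply/existsP; exists K; rewrite copyK KR eqxx /=.
have := coloring_card K col; rewrite (is_copy_card copyK) KR -rb.
by move=> /addnI ->.
Qed.

Lemma missing_pattern_iff n0 R B : amoeba_threshold G n0 -> n0 <= n ->
  coloring R B ->
  (exists r b, r + b = #|edges G| /\ ~~ colored_copy G R B r b) <->
  (~~ contains_copy G R \/ ~~ contains_copy G B).
Proof.
move=> thr le_n col; split=> [[r [b [rb]]]|].
  case cR: (contains_copy G R); last by left.
  case cB: (contains_copy G B); last by right.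
  by rewrite (all_colors_of_amoeba thr le_n col cR cB rb).
case=> [ncR|ncB].
  exists #|edges G|, 0; split; first exact: addn0.
  exact: contra (@contains_copy_monochromatic R B) ncR.
exists 0, #|edges G|; split=> //; rewrite colored_copyC.
exact: contra (@contains_copy_monochromatic B R) ncB.
Qed.

Lemma ot_le_ex n0 : amoeba_threshold G n0 -> n0 <= n -> ot n G <= ex n G.
Proof.
move=> thr le_n; rewrite /ot; case: ex_minnP => m _; apply.
apply/forallP => R; apply/forallP => B; apply/implyP => /andP[col].
rewrite leq_min => /andP[exR exB]; apply/all_colored_copiesP.
by apply: (all_colors_of_amoeba thr) => //; apply: contains_copy_ex.
Qed.

Lemma ex_le_ot : edges G != set0 -> 2 * ex n G + 1 <= 'C(n, 2) ->
  ex n G <= ot n G.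
Proof.
move=> G_edge half; rewrite /ot; case: ex_minnP => m bound_m _.
rewrite leqNgt; apply/negP => lt_m.
have [H] := ex_attained n G_edge; rewrite inE => /andP[ncH /eqP cardH].
have [B col] := coloring_complement H; have := coloring_total col.
rewrite cardH => total.
(* The complement has at least ex + 1 edges, so [H] is the smaller class. *)
have lt_B : m < #|edges B| by lia.
have /forallP/(_ H)/forallP/(_ B) := bound_m.
rewrite col cardH leq_min lt_m lt_B /= => /all_colored_copiesP all_copies.
by case/negP: ncH; apply/contains_copy_monochromatic/all_copies/addn0.
Qed.

(** Color a member of [O1] red. Its complement has more than ot edges, so it is isomorphic to no
    member of [O2]; the red class must be. *)
Lemma is_Ot_inclusion (O1 O2 : {set graph 'I_n}) :
  2 * ot n G + 1 <= 'C(n, 2) -> is_Ot G O1 -> is_Ot G O2 -> O1 \subset O2.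
Proof.
move=> half [_ card1 char1] [iso2 card2 char2]; apply/subsetP => H HO1.
have [B col] := coloring_complement H; have := coloring_total col.
have cardH := card1 _ HO1; rewrite cardH => total.
have minE : minn #|edges H| #|edges B| = ot n G by lia.
have /(char2 _ _ col minE)[K KO2 [HK|BK]] :
    exists r b, r + b = #|edges G| /\ ~~ colored_copy G H B r b.
  by apply/(char1 _ _ col minE); exists H => //; left; apply: iso_refl.
- exact: iso2 (iso_sym HK) KO2.
- by have := iso_card BK; rewrite (card2 _ KO2); lia.
Qed.

Lemma is_Ot_Ex n0 : amoeba_threshold G n0 -> n0 <= n -> ot n G = ex n G ->
  is_Ot G (Ex n G).
Proof.
move=> thr le_n otE.
have iso_Ex H1 H2 : iso H1 H2 -> H1 \in Ex n G -> H2 \in Ex n G.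
  move=> H12; rewrite !inE (iso_card H12) => /andP[ncH ->]; rewrite andbT.
  exact: contra (contains_copy_iso (iso_sym H12)) ncH.
(* Both classes have at least ex edges, so a G-free one has exactly ex and is extremal. *)
have in_Ex H : ex n G <= #|edges H| -> ~~ contains_copy G H -> H \in Ex n G.
  move=> le_H ncH; rewrite inE ncH eqn_leq le_H andbT.
  by rewrite leqNgt; apply: contra ncH => /contains_copy_ex.
split=> [//|H|R B col minE]; first by rewrite inE otE => /andP[_ /eqP].
rewrite (missing_pattern_iff thr le_n col); split.
  case=> [ncR|ncB]; [exists R | exists B].
  - by apply: in_Ex; rewrite // -otE -minE geq_minl.
  - by left; apply: iso_refl.
  - by apply: in_Ex; rewrite // -otE -minE geq_minr.
  - by right; apply: iso_refl.
case=> K KEx [RK|BK]; [left|right].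
  by have := iso_Ex _ _ (iso_sym RK) KEx; rewrite inE => /andP[].
by have := iso_Ex _ _ (iso_sym BK) KEx; rewrite inE => /andP[].
Qed.

End Colorings.

Theorem theorem2p14 (T : finType) (G : graph T) (G_edge : edges G != set0)
    (G_bipartite : bipartite G) (G_amoeba : amoeba G) :
  omnitonal G /\
  forall n0 n : nat, amoeba_threshold G n0 ->
    2 * ex n G + 1 <= 'C(n, 2) -> n0 <= n ->
    ot n G = ex n G /\
    (forall O : {set graph 'I_n}, is_Ot G O <-> O = Ex n G).
Proof.
split.
  have [n0 thr] := G_amoeba; have [N dense] := ex_lt_half G_bipartite.
  exists (maxn n0 N) => n; rewrite geq_max => /andP[n0n Nn].
  exact: leq_ltn_trans (ot_le_ex thr n0n) (dense n Nn).
move=> n0 n thr half n0n.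
have otE : ot n G = ex n G.
  by apply/eqP; rewrite eqn_leq (ot_le_ex thr) // ex_le_ot.
have Ot_Ex := is_Ot_Ex thr n0n otE.
split=> // O; split=> [Ot_O|-> //].
have incl := @is_Ot_inclusion _ G n; rewrite otE in incl.
by apply/eqP; rewrite eqEsubset !incl.
Qed.
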